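(* Let $T$ be an $n\times n$ real symmetric tridiagonal matrix with diagonal elements $\alpha_1,\ldots,\alpha_n$, and assume the floating point assumptions stated in the context. If $$\hat{c}_1^{(i)}=\mathrm{fl}\left[\hat{c}_1^{(i-1)}-\alpha_i\right],\qquad 2\leq i\leq n,$$ then $$|e_1^{(i)}|\leq |e_1^{(i-1)}|+u\,|\hat c_1^{(i)}|, \qquad 2\leq i\leq n.$$
   Context: $T$ has diagonal elements $\alpha_1,\ldots,\alpha_n$ and off-diagonal elements $\beta_2,\ldots,\beta_n$ ($\beta_i$ in positions $(i-1,i)$ and $(i,i-1)$). $T_i$ is the leading principal submatrix of $T$ of order $i$, and $\det(\lambda I-T_i)=\lambda^i+c_1^{(i)}\lambda^{i-1}+\cdots+c_{i-1}^{(i)}\lambda+c_i^{(i)}$, $1\le i\le n$. Thus $c_1^{(1)}=-\alpha_1$ and $c_1^{(i)}=c_1^{(i-1)}-\alpha_i$ for $2\le i\le n$. Floating point assumptions: all matrix elements are normalized real floating point numbers; $u$ is the unit roundoff and $nu<1$; no operation underflows or overflows; $\mathrm{fl}[\cdot]$ denotes the result computed in floating point arithmetic. For $\mathrm{op}\in\{+,-,\times,/\}$ and normalized real floating point numbers $x,y$ such that $x\ \mathrm{op}\ y$ does not underflow or overflow, $\mathrm{fl}[x\ \mathrm{op}\ y]=(x\ \mathrm{op}\ y)(1+\delta)$ for some $|\delta|\le u$, and also $\mathrm{fl}[x\ \mathrm{op}\ y]=(x\ \mathrm{op}\ y)/(1+\epsilon)$ for some $|\epsilon|\le u$. $\hat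 c_j^{(i)}$ denotes the floating point computed value of $c_j^{(i)}$, with error $e_j^{(i)}=\hat c_j^{(i)}-c_j^{(i)}$. The starting value is exact: $\hat c_1^{(1)}=c_1^{(1)}=-\alpha_1$, so $e_1^{(1)}=0$. *)

(* Defs.v *)
From HB Require Import structures.
From mathcomp Require Import all_boot all_order all_algebra.
From mathcomp Require Import reals.
Set Implicit Arguments.
Unset Strict Implicit.
Unset Printing Implicit Defensive.
Import Order.TTheory GRing.Theory Num.Theory.
Local Open Scope ring_scope.

Record fp_format := FPFormat {
  fp_base : nat;
  fp_prec : nat;
  fp_emin : int;
  fp_emax : int;
  fp_base_gt1 : (1 < fp_base)%N;
  fp_prec_gt0 : (0 < fp_prec)%N;
  fp_emin_le_emax : fp_emin <= fp_emax }.

(* Zero has no normalized representation, but it belongs to the number system: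
   it occurs as a matrix entry and as the result of x - x.  Subnormal numbers
   are excluded by the lower bound on the integral significand m. *)
Definition fp_number (R : realType) (F : fp_format) (x : R) : Prop :=
  x = 0 \/
  exists (m e : int),
    [/\ (fp_base F ^ (fp_prec F).-1 <= `|m| < fp_base F ^ fp_prec F)%N,
        fp_emin F <= e <= fp_emax F
      & x = m%:~R * (fp_base F)%:R ^ e].

Inductive fp_op := OpAdd | OpSub | OpMul | OpDiv.

Definition exact_op (R : realType) (op : fp_op) (x y : R) : R :=
  match op with
  | OpAdd => x + y
  | OpSub => x - y
  | OpMul => x * y
  | OpDiv => x / y
  end.

(* The value of fl is unconstrained on operations that underflow or overflow,
   and on divisions by zero.  Which operations raise these exceptions (tininess
   detected before or after rounding, rounding to the largest number near the
   overflow threshold) varies between implementations and is left as data; so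
   is the rounding mode, of which only the bound u is used. *)
Record fp_arith (R : realType) (F : fp_format) := FPArith {
  unit_roundoff : R;
  fl : fp_op -> R -> R -> R;
  underflows : fp_op -> R -> R -> Prop;
  overflows : fp_op -> R -> R -> Prop;
  unit_roundoff_gt0 : 0 < unit_roundoff;
  fl_number : forall (op : fp_op) (x y : R),
    fp_number F x -> fp_number F y -> (op = OpDiv -> y != 0) ->
    ~ underflows op x y -> ~ overflows op x y ->
    fp_number F (fl op x y);
  fl_mul_model : forall (op : fp_op) (x y : R),
    fp_number F x -> fp_number F y -> (op = OpDiv -> y != 0) ->
    ~ underflows op x y -> ~ overflows op x y ->
    exists2 delta : R, `|delta| <= unit_roundoff
      & fl op x y = exact_op op x y * (1 + delta);
  fl_div_model : forall (op : fp_op) (x y : R),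
    fp_number F x -> fp_number F y -> (op = OpDiv -> y != 0) ->
    ~ underflows op x y -> ~ overflows op x y ->
    exists2 eps : R, `|eps| <= unit_roundoff
      & fl op x y = exact_op op x y / (1 + eps) }.

Definition tridiagonal (R : realType) (n : nat) (T : 'M[R]_n) : Prop :=
  forall i j : 'I_n, (i.+1 < j)%N || (j.+1 < i)%N -> T i j = 0.

Definition leading_submx (R : realType) (n i : nat) (le_i_n : (i <= n)%N)
    (T : 'M[R]_n) : 'M[R]_i :=
  mxsub (widen_ord le_i_n) (widen_ord le_i_n) T.

(* c i j stands for c_j^(i), and is determined only for 1 <= j <= i <= n. *)
Definition leading_char_coefs (R : realType) (n : nat) (T : 'M[R]_n)
    (c : nat -> nat -> R) : Prop :=
  forall (i : nat) (le_i_n : (i <= n)%N), (1 <= i)%N ->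
    char_poly (leading_submx le_i_n T) =
      'X^i + \sum_(1 <= j < i.+1) c i j *: 'X^(i - j).

Definition coef_error (R : realType) (chat c : nat -> nat -> R) (i j : nat) : R :=
  chat i j - c i j.

(* Main.v *)
Require Import Defs.
From mathcomp Require Import all_boot all_order all_algebra.
From mathcomp Require Import reals.
From mathcomp Require Import ring lra.
Import Order.TTheory GRing.Theory Num.Theory.
Local Open Scope ring_scope.

(** The coefficient [c_1^(i)] is minus the trace of the leading submatrix, so it
    satisfies exactly the recurrence that is evaluated in floating point. Writing
    the computed value as [(exact) / (1 + eps)], the local error is
    [- eps * chat_1^(i)], and the error of the previous step is carried over
    unamplified. *)

(** Negating the significand [m] preserves its absolute value. This is needed because the recurrence
    starts from [- alpha 1]. *)
Lemma fp_numberN (R : realType) (F : fp_format) (x : R) :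
  fp_number F x -> fp_number F (- x).
Proof.
case=> [->|[m [e [m_bounds e_bounds ->]]]]; first by left; rewrite oppr0.
by right; exists (- m), e; split; rewrite ?abszN // mulrNz mulNr.
Qed.

Lemma leading_char_coef1 (R : realType) (n : nat) (T : 'M[R]_n)
    (c : nat -> nat -> R) (alpha : nat -> R) (i : nat) :
  leading_char_coefs T c -> (forall k : 'I_n, T k k = alpha k.+1) ->
  (0 < i <= n)%N -> c i 1%N = - \sum_(k < i) alpha k.+1.
Proof.
move=> c_def T_diag /andP[i_gt0 le_i_n].
transitivity (- \tr (leading_submx le_i_n T)); last first.
  by congr (- _); apply: eq_bigr => k _; rewrite mxE T_diag.
(* Compare coefficients of degree [i.-1]: ['X^i] has higher degree, the terms with [j > 1] have
   lower degree, and only [j = 1] contributes. *)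
rewrite -char_poly_trace // (c_def i le_i_n i_gt0) coefD coefXn coef_sum.
rewrite big_ltn // coefZ coefXn subn1 eqxx mulr1.
rewrite ltn_eqF ?add0r; last by rewrite prednK.
rewrite big_nat big1 ?addr0 // => j /andP[j_gt1 lt_j_i].
rewrite coefZ coefXn gtn_eqF ?mulr0 // -subn1.
by apply: ltn_sub2l => //; apply: leq_trans j_gt1 _.
Qed.

(** The division model measures the error against the computed value; the multiplicative model would
    bound it by a multiple of [|x - y|] instead. *)
Lemma fl_sub_error (R : realType) (F : fp_format) (A : fp_arith R F) (x y : R) :
  unit_roundoff A < 1 -> fp_number F x -> fp_number F y ->
  ~ underflows A OpSub x y -> ~ overflows A OpSub x y ->
  `|fl A OpSub x y - (x - y)| <= unit_roundoff A * `|fl A OpSub x y|.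
Proof.
move=> u_lt1 x_fp y_fp no_under no_over.
have op_ok : OpSub = OpDiv -> y != 0 by [].
have [eps eps_le fl_eq] := fl_div_model x_fp y_fp op_ok no_under no_over.
(* Since [|eps| <= u < 1], [1 + eps] is positive and the division can be undone. *)
have eps1_neq0 : 1 + eps != 0.
  by move: eps_le; rewrite ler_norml => /andP[eps_ge _]; apply: lt0r_neq0; lra.
have -> : x - y = fl A OpSub x y * (1 + eps) by rewrite fl_eq divfK.
rewrite mulrDr mulr1 opprD addNKr normrN normrM mulrC.
by rewrite ler_wpM2r.
Qed.

Theorem theorem4p2 (R : realType) (F : fp_format) (A : fp_arith R F)
    (n : nat) (T : 'M[R]_n) (alpha : nat -> R) (c chat : nat -> nat -> R)
    (T_sym : T^T = T)
    (T_tridiagonal : tridiagonal T)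
    (T_diag : forall k : 'I_n, T k k = alpha k.+1)
    (T_fp : forall k l : 'I_n, fp_number F (T k l))
    (nu_lt1 : n%:R * unit_roundoff A < 1)
    (c_def : leading_char_coefs T c)
    (chat_start : chat 1%N 1%N = - alpha 1%N)
    (chat_step : forall i : nat, (2 <= i <= n)%N ->
       chat i 1%N = fl A OpSub (chat i.-1 1%N) (alpha i))
    (no_exception : forall i : nat, (2 <= i <= n)%N ->
       ~ underflows A OpSub (chat i.-1 1%N) (alpha i) /\
       ~ overflows A OpSub (chat i.-1 1%N) (alpha i)) :
  forall i : nat, (2 <= i <= n)%N ->
    `|coef_error chat c i 1| <=
      `|coef_error chat c i.-1 1| + unit_roundoff A * `|chat i 1%N|.
Proof.
have alpha_fp k : (k < n)%N -> fp_number F (alpha k.+1).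
  by move=> lt_k_n; rewrite -(T_diag (Ordinal lt_k_n)).
(* The rounding models accept only floating point operands, so every computed coefficient must be
   shown, by induction, to be one. *)
have chat_fp k : (k < n)%N -> fp_number F (chat k.+1 1%N).
  elim: k => [|k IHk] lt_k_n.
    by rewrite chat_start; apply/fp_numberN/alpha_fp.
  have [no_under no_over] := no_exception k.+2 lt_k_n.
  rewrite (chat_step k.+2 lt_k_n); apply: fl_number => //.
    by apply/IHk/ltnW.
  exact: alpha_fp.
case=> [|[|i]] // i_bounds; have lt_i_n : (i.+1 < n)%N by [].
(* As [n >= 1] and [u > 0], [u <= n u < 1]. *)
have u_lt1 : unit_roundoff A < 1.
  apply: le_lt_trans nu_lt1; rewrite ler_peMl ?ler1n ?(leq_trans _ lt_i_n) //.
  exact/ltW/unit_roundoff_gt0.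
have [no_under no_over] := no_exception i.+2 i_bounds.
have := fl_sub_error _ _ A _ _ u_lt1 (chat_fp i (ltnW lt_i_n))
  (alpha_fp _ lt_i_n) no_under no_over.
rewrite -(chat_step i.+2 i_bounds) => local_error.
(* The traces of consecutive leading submatrices differ by the last diagonal entry. *)
have c_rec : c i.+2 1%N = c i.+1 1%N - alpha i.+2.
  rewrite !(fun k => leading_char_coef1 _ _ _ _ _ k c_def T_diag) ?(ltnW lt_i_n) //.
  by rewrite big_ord_recr opprD.
rewrite /coef_error /= c_rec.
have -> : chat i.+2 1%N - (c i.+1 1%N - alpha i.+2) =
    (chat i.+1 1%N - c i.+1 1%N) +
    (chat i.+2 1%N - (chat i.+1 1%N - alpha i.+2)) by ring.
by apply: le_trans (ler_normD _ _) _; rewrite lerD2l.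
Qed.
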